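(* Let $\rho_2:=\sqrt{5+2\sqrt{3}}$. There is an algorithm which, given a finite set $X\subseteq\mathbb{R}^d$ of $n$ points, computes in time polynomial in $n$ a subset $Y\subseteq X$ such that $\lVert y-y'\rVert_2>2$ for all distinct $y,y'\in Y$ (that is, the closed Euclidean unit balls centered at the points of $Y$ are pairwise disjoint) and $$\Big|\bigcup_{y\in Y}B(y,1)\Big|\ \geq\ \frac{1}{2^d+\rho_2^d}\ \Big|\bigcup_{x\in X}B(x,1)\Big|.$$
   Context: $B(x,1)=\{z\in\mathbb{R}^d:\lVert z-x\rVert_2\le 1\}$ is the closed Euclidean unit ball centered at $x$, and $|E|$ is the Lebesgue measure of $E\subseteq\mathbb{R}^d$. Running time is counted with the test of whether two given unit balls $B(x,1),B(x',1)$ intersect (i.e. whether $\lVert x-x'\rVert_2\le 2$) taken as a unit-cost operation. *)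

(* Defs.v *)
From HB Require Import structures.
From mathcomp Require Import all_boot all_order all_algebra.
From mathcomp Require Import all_classical all_reals all_analysis.

Set Implicit Arguments.
Unset Strict Implicit.
Unset Printing Implicit Defensive.

Import Order.TTheory GRing.Theory Num.Theory.

Local Open Scope classical_set_scope.
Local Open Scope ring_scope.

(** * Lebesgue measure on R^d

    R^d is [d.-tuple R]: this is the type that carries the library's product
    (= Borel) sigma-algebra.  The measure is the d-fold product of the
    one-dimensional one; [lebesgueRd_box] gives its values on boxes, which
    determine it on Borel sets. *)

Section cons_measure.
Context (R : realType) (n : nat).
Variable m : {sigma_finite_measure set (n.-tuple (measurableTypeR R)) -> \bar R}.

Definition cons_pair (x : measurableTypeR R * n.-tuple (measurableTypeR R)) :
    n.+1.-tuple (measurableTypeR R) :=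
  [the n.+1.-tuple _ of x.1 :: x.2].

Lemma measurable_cons_pair : measurable_fun setT cons_pair.
Proof. exact: measurable_cons. Qed.

Definition cons_measure : set (n.+1.-tuple (measurableTypeR R)) -> \bar R :=
  pushforward (@lebesgue_measure R \x m)%E cons_pair.

Let cons_measure0 : cons_measure set0 = 0%E.
Proof. by rewrite /cons_measure /pushforward preimage_set0 measure0. Qed.

Let cons_measure_ge0 A : (0 <= cons_measure A)%E.
Proof. exact: (measure_ge0 (@lebesgue_measure R \x m)%E). Qed.

Let cons_measure_sigma_additive : semi_sigma_additive cons_measure.
Proof.
move=> F mF tF mUF; rewrite /cons_measure /pushforward preimage_bigcup.
have mpre A : measurable A -> measurable (cons_pair @^-1` A).
  by move=> mA; rewrite -[X in measurable X]setTI; exact: measurable_cons_pair.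
apply: measure_semi_sigma_additive; first by move=> k; exact: mpre.
- apply/trivIsetP => /= i j _ _ ij; rewrite -preimage_setI.
  by move/trivIsetP : tF => /(_ _ _ _ _ ij) ->//; rewrite preimage_set0.
- by rewrite -preimage_bigcup; exact: mpre.
Qed.

HB.instance Definition _ := isMeasure.Build _ _ _ cons_measure
  cons_measure0 cons_measure_ge0 cons_measure_sigma_additive.

Let cons_measure_sigma_finite : sigma_finite setT cons_measure.
Proof.
have /sigma_finiteP[F [TF ndF Foo]] := sigma_finiteT (@lebesgue_measure R).
have /sigma_finiteP[G [TG ndG Goo]] := sigma_finiteT m.
pose unc (z : n.+1.-tuple (measurableTypeR R)) :
    measurableTypeR R * n.-tuple (measurableTypeR R) :=
  (thead z, [tuple of behead z]).
have uncK : cancel cons_pair unc.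
  by move=> [x t]; congr pair => //; apply/val_inj.
have munc : measurable_fun setT unc.
  apply/measurable_fun_pairP; split => /=; first exact: measurable_tnth.
  exact: measurable_behead.
exists (fun k => unc @^-1` (F k `*` G k)).
  apply/seteqP; split => // z _.
  have [i _ Fi] : (\bigcup_i F i) (unc z).1 by rewrite -TF.
  have [j _ Gj] : (\bigcup_j G j) (unc z).2 by rewrite -TG.
  exists (maxn i j) => //; split.
    by move: Fi; exact/subsetPset/ndF/leq_maxl.
  by move: Gj; exact/subsetPset/ndG/leq_maxr.
move=> k; have [mF Fk] := Foo k; have [mG Gk] := Goo k; split.
  by rewrite -[X in measurable X]setTI; apply: munc => //; exact: measurableX.
rewrite /cons_measure /pushforward -comp_preimage.
rewrite (_ : unc \o cons_pair = id); last by apply/funext => x /=; rewrite uncK.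
by rewrite preimage_id product_measure1E// lte_mul_pinfty// ge0_fin_numE.
Qed.

HB.instance Definition _ := @Measure_isSigmaFinite.Build _ _ _
  cons_measure cons_measure_sigma_finite.

End cons_measure.

Fixpoint lebesgueRd (R : realType) (d : nat) :
    {sigma_finite_measure set (d.-tuple (measurableTypeR R)) -> \bar R} :=
  match d with
  | 0 => @dirac _ (0.-tuple (measurableTypeR R)) [tuple] R
  | d'.+1 => cons_measure (lebesgueRd R d')
  end.

Lemma lebesgueRd_box (R : realType) (d : nat) (a b : d.-tuple R) :
  (forall i, tnth a i <= tnth b i) ->
  lebesgueRd R d [set z | forall i, tnth a i <= tnth z i <= tnth b i] =
  (\prod_(i < d) (tnth b i - tnth a i))%:E.
Proof.
elim: d a b => [|d IHd] a b ab.
  by rewrite big_ord0 /= diracE mem_set// => -[].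
rewrite big_ord_recl EFinM /= /cons_measure /pushforward.
pose a' := [tuple of behead a]; pose b' := [tuple of behead b].
have a'E i : tnth a' i = tnth a (lift ord0 i) by rewrite [in RHS](tuple_eta a) tnthS.
have b'E i : tnth b' i = tnth b (lift ord0 i) by rewrite [in RHS](tuple_eta b) tnthS.
pose box := [set z : d.-tuple R | forall i, tnth a' i <= tnth z i <= tnth b' i].
have -> : @cons_pair R d @^-1` [set z | forall i, tnth a i <= tnth z i <= tnth b i] =
    `[tnth a ord0, tnth b ord0] `*` box.
  apply/seteqP; split => [[x t] /= H|[x t] /= [H1 H2] i].
    split; first by have := H ord0; rewrite in_itv.
    by move=> i; have := H (lift ord0 i); rewrite tnthS a'E b'E.
  have [->|[j ->]] : i = ord0 \/ exists j, i = lift ord0 j.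
    by case: (unliftP ord0 i) => [j ->|->]; [right; exists j|left].
  - by move: H1; rewrite in_itv.
  - by rewrite tnthS -a'E -b'E; exact: H2.
have mbox : @measurable _ (d.-tuple (measurableTypeR R)) box.
  have -> : box = \bigcap_(i in [set: 'I_d])
      ((fun z : d.-tuple (measurableTypeR R) => tnth z i) @^-1`
        `[tnth a' i, tnth b' i]).
    apply/seteqP; split => z H i => [_|]; first by rewrite /= in_itv; exact: H.
    by have := H i I; rewrite /= in_itv.
  apply: fin_bigcap_measurable => // i _.
  by rewrite -[X in measurable X]setTI; exact: measurable_tnth.
rewrite product_measure1E//= lebesgue_measure_itv /= IHd; last first.
  by move=> i; rewrite a'E b'E.
congr (_ * _)%E; last by congr EFin; apply: eq_bigr => i _; rewrite a'E b'E.
by rewrite lte_fin; case: ltgtP (ab ord0) => // -> _; rewrite subrr.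
Qed.

Definition eucl_dist (R : realType) (d : nat) (x y : d.-tuple R) : R :=
  Num.sqrt (\sum_(i < d) (tnth x i - tnth y i) ^+ 2).

Definition unit_ball (R : realType) (d : nat) (x : d.-tuple R) :
    set (d.-tuple R) :=
  [set z | eucl_dist z x <= 1].

Definition union_unit_balls (R : realType) (d : nat) (X : seq (d.-tuple R)) :
    set (d.-tuple R) :=
  \bigcup_(x in [set` X]) unit_ball x.

Definition rho2 (R : realType) : R := Num.sqrt (5 + 2 * Num.sqrt 3).

(** * Algorithms

    A random access machine with structured control, with registers and an
    array of natural numbers.  Its only access to the geometric input is
    [Test], which decides whether the unit balls centered at the points of two
    given indices intersect.  Every instruction and every evaluation of a guard
    costs one unit.  There is neither multiplication nor shift, so a number has
    at most linearly many bits in the elapsed time, and unit cost is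
    polynomially equivalent to bit cost.  Below, r, a, b name registers and, on
    the right of :=, stand for their contents; array indices are contents too. *)

Inductive instr : Type :=
| Const (r k : nat)   (* r := k *)
| Add (r a b : nat)   (* r := a + b *)
| Sub (r a b : nat)   (* r := a - b, truncated at 0 *)
| ReadArr (r a : nat) (* r := array[a] *)
| WriteArr (a b : nat) (* array[a] := b *)
| Test (r a b : nat). (* r := 1 if balls number a and b intersect, else 0 *)

Inductive cmd : Type :=
| Do (i : instr)
| Seq (c1 c2 : cmd)
| If (r : nat) (c1 c2 : cmd) (* guard: register r is nonzero *)
| While (r : nat) (c : cmd).

Record state := State { reg : nat -> nat; arr : nat -> nat }.

Definition set_reg (s : state) (r v : nat) : state :=
  State [eta reg s with r |-> v] (arr s).

Definition set_arr (s : state) (a v : nat) : state :=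
  State (reg s) [eta arr s with a |-> v].

Definition run_instr (test : rel nat) (i : instr) (s : state) : state :=
  match i with
  | Const r k => set_reg s r k
  | Add r a b => set_reg s r (reg s a + reg s b)%N
  | Sub r a b => set_reg s r (reg s a - reg s b)%N
  | ReadArr r a => set_reg s r (arr s (reg s a))
  | WriteArr a b => set_arr s (reg s a) (reg s b)
  | Test r a b => set_reg s r (test (reg s a) (reg s b))
  end.

(** [exec test c s t s'] : started in [s], [c] halts in [s'] after [t] units
    of time. *)
Inductive exec (test : rel nat) : cmd -> state -> nat -> state -> Prop :=
| ExecDo i s : exec test (Do i) s 1 (run_instr test i s)
| ExecSeq c1 c2 s t1 s1 t2 s2 :
    exec test c1 s t1 s1 -> exec test c2 s1 t2 s2 ->
    exec test (Seq c1 c2) s (t1 + t2) s2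
| ExecIfTrue r c1 c2 s t s' :
    reg s r != 0%N -> exec test c1 s t s' -> exec test (If r c1 c2) s t.+1 s'
| ExecIfFalse r c1 c2 s t s' :
    reg s r = 0%N -> exec test c2 s t s' -> exec test (If r c1 c2) s t.+1 s'
| ExecWhileTrue r c s t1 s1 t2 s2 :
    reg s r != 0%N -> exec test c s t1 s1 ->
    exec test (While r c) s1 t2 s2 ->
    exec test (While r c) s (t1 + t2).+1 s2
| ExecWhileFalse r c s : reg s r = 0%N -> exec test (While r c) s 1 s.

Lemma exec_det (test : rel nat) c s t1 s1 t2 s2 :
  exec test c s t1 s1 -> exec test c s t2 s2 -> t1 = t2 /\ s1 = s2.
Proof.
move=> H; elim: H t2 s2 => {c s t1 s1}.
- by move=> i s t2 s2 H; inversion H.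
- move=> c1 c2 s t1 s1 t2 s2 _ IH1 _ IH2 t s' H; inversion H; subst.
  have [? ?] := IH1 _ _ ltac:(eassumption); subst.
  by have [-> ->] := IH2 _ _ ltac:(eassumption).
- move=> r c1 c2 s t s' r0 _ IH u s'' H; inversion H; subst.
    by have [-> ->] := IH _ _ ltac:(eassumption).
  by move: r0; rewrite (_ : reg s r = 0%N).
- move=> r c1 c2 s t s' r0 _ IH u s'' H; inversion H; subst.
    by move: r0 => /eqP; rewrite (negPf ltac:(eassumption)).
  by have [-> ->] := IH _ _ ltac:(eassumption).
- move=> r c s t1 s1 t2 s2 r0 _ IH1 _ IH2 t s' H; inversion H; subst.
    have [? ?] := IH1 _ _ ltac:(eassumption); subst.
    by have [-> ->] := IH2 _ _ ltac:(eassumption).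
  by move: r0; rewrite (_ : reg s' r = 0%N).
- move=> r c s r0 t s' H; inversion H; subst => //.
  by move: r0 => /eqP; rewrite (negPf ltac:(eassumption)).
Qed.

(** The set X is presented by an enumeration of its points.  At the start
    register 0 holds the number of points and everything else is 0; at the end
    the i-th point is selected when the i-th array cell is nonzero. *)

Definition ball_test (R : realType) (d : nat) (X : seq (d.-tuple R)) : rel nat :=
  fun i j => match onth X i, onth X j with
             | Some x, Some y => eucl_dist x y <= 2
             | _, _ => false
             end.

Definition initial (n : nat) : state :=
  set_reg (State (fun=> 0%N) (fun=> 0%N)) 0 n.

Definition selected (R : realType) (d : nat) (X : seq (d.-tuple R)) (s : state) :
    seq (d.-tuple R) :=
  [seq x <- X | arr s (index x X) != 0%N].

(* Main.v *)
(** Start from one ball and, while some two disjoint balls of X together meet at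
    most one chosen ball, insert them in place of what they meet; each such swap
    enlarges the chosen set Y, so n rounds over all pairs reach an optimum.

    There, a ball of X meeting at least two balls of Y is covered by the
    concentric balls of radius rho2 around Y.  The balls meeting only y in Y
    have centers at mutual distance at most 2, so their union has diameter at
    most 4 and, by the isodiametric inequality, volume at most 2^d times that of
    the unit ball.

    The isodiametric inequality is Brunn-Minkowski in the multiplicative form
    |A| |B| <= |(A + B) / 2|^2 applied to A and -A, and that form follows by
    induction on d from the one-dimensional Prekopa-Leindler inequality for the
    measures of the sections. *)

Require Import Defs.
From mathcomp Require Import all_boot all_order all_algebra.
From mathcomp Require Import all_classical all_reals all_analysis.
From mathcomp Require Import measurable_realfun measurable_fun_approximation.
From mathcomp Require Import zify ring lra.

Set Implicit Arguments.
Unset Strict Implicit.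
Unset Printing Implicit Defensive.

Import Order.TTheory GRing.Theory Num.Theory.

(** * Local search on the random access machine *)

Local Open Scope nat_scope.

(** Exhibiting one halting run within the bound is enough, because [exec] is deterministic by
    [exec_det]. *)
Definition wp (test : rel nat) (c : cmd) (s : state) (T : nat) (Q : state -> Prop) :=
  exists t s', [/\ exec test c s t s', t <= T & Q s'].

Lemma wp_do test i s (Q : state -> Prop) T :
  0 < T -> Q (run_instr test i s) -> wp test (Do i) s T Q.
Proof. by move=> T0 q; exists 1, (run_instr test i s); split => //; constructor. Qed.

Lemma wp_seq T1 T2 test c1 c2 s T Q :
  T1 + T2 <= T -> wp test c1 s T1 (fun s1 => wp test c2 s1 T2 Q) ->
  wp test (Seq c1 c2) s T Q.
Proof.
move=> TT [t1 [s1 [e1 l1 [t2 [s2 [e2 l2 q]]]]]]; exists (t1 + t2), s2; split => //.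
  exact: ExecSeq e1 e2.
by rewrite (leq_trans _ TT)// leq_add.
Qed.

Lemma wp_if test r c1 c2 s T Q :
  (reg s r != 0 -> wp test c1 s T Q) -> (reg s r = 0 -> wp test c2 s T Q) ->
  wp test (If r c1 c2) s T.+1 Q.
Proof.
move=> w1 w2; have [r0|r0] := eqVneq (reg s r) 0.
  by have [t [s' [e l q]]] := w2 r0; exists t.+1, s'; split => //; exact: ExecIfFalse.
by have [t [s' [e l q]]] := w1 r0; exists t.+1, s'; split => //; exact: ExecIfTrue.
Qed.

Lemma wp_weaken test c s T T' (Q Q' : state -> Prop) :
  T <= T' -> (forall s', Q s' -> Q' s') -> wp test c s T Q -> wp test c s T' Q'.
Proof.
move=> TT QQ [t [s' [e l q]]]; exists t, s'; split => //; last exact: QQ.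
exact: leq_trans TT.
Qed.

(* Register 1 holds the constant 1. *)
Definition downto (r : nat) (c : cmd) : cmd := While r (Seq (Do (Defs.Sub r r 1)) c).

Lemma wp_downto test r c T (Inv : nat -> state -> Prop) m s :
  (forall k s, Inv k s -> reg s r = k /\ reg s 1 = 1) ->
  (forall k s, k < m -> Inv k.+1 s -> wp test c (set_reg s r k) T (Inv k)) ->
  Inv m s -> wp test (downto r c) s (m * T.+2 + 1) (Inv 0).
Proof.
move=> regE step; elim: m step s => [|m IH] step s inv; have [rE oneE] := regE _ _ inv.
  by exists 1, s; split => //; exact: ExecWhileFalse.
have [t1 [s1 [e1 l1 inv1]]] := step m s (ltnSn m) inv.
have [t2 [s2 [e2 l2 inv2]]] := IH (fun k s km => step k s (ltnW km)) s1 inv1.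
exists ((1 + t1) + t2).+1, s2; split => //; last by lia.
apply: ExecWhileTrue e2; first by rewrite rE.
apply: ExecSeq e1; rewrite -[m](subn1 m.+1) -rE -[X in _ - X]oneE.
exact: ExecDo.
Qed.

(** * The program and the cost of its subroutines *)

Definition skip : cmd := Do (Const 7 0).

(* Registers: 0 number of points, 1 constant 1, 2 rounds left, 3 and 4 the pair
   (i, j) of balls to insert, 5 the ball k under inspection, 6 number of
   conflicts, 7-9 scratch, 10 constant 0. *)
Definition conflict : cmd :=
  Seq (Do (Test 8 5 3)) (Seq (Do (Test 9 5 4)) (Do (Add 8 8 9))).

Definition count_conflicts : cmd :=
  Seq (Do (Const 6 0)) (Seq (Do (Add 5 0 10))
    (downto 5 (Seq (Do (ReadArr 7 5))
      (If 7 (Seq conflict (If 8 (Do (Add 6 6 1)) skip)) skip)))).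

(** Erasing precedes inserting: a ball meets itself, so in the opposite order i and j would be
    erased again. *)
Definition swap : cmd :=
  Seq (Do (Add 5 0 10)) (Seq
    (downto 5 (Seq conflict (If 8 (Do (WriteArr 5 10)) skip)))
    (Seq (Do (WriteArr 3 1)) (Do (WriteArr 4 1)))).

(** Truncated subtraction of 1 sends exactly the conflict counts 0 and 1 to 0. *)
Definition try_swap : cmd :=
  Seq (Do (Test 7 3 4)) (If 7 skip
    (Seq count_conflicts (Seq (Do (Defs.Sub 6 6 1)) (If 6 skip swap)))).

(** Register 10 is never written and keeps its initial 0. Adding it copies a register, and the first
    array write chooses ball number 0. *)
Definition local_search : cmd :=
  Seq (Do (Const 1 1)) (Seq (Do (WriteArr 10 1)) (Seq (Do (Add 2 0 10))
    (downto 2 (Seq (Do (Add 3 0 10))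
      (downto 3 (Seq (Do (Add 4 0 10))
        (downto 4 try_swap))))))).

(** Registers 5 to 9 are the only ones that [try_swap] writes, so constants and outer loop counters
    survive it. *)
Definition frame (s s' : state) :=
  forall r, ~~ (5 <= r <= 9) -> reg s' r = reg s r.

Lemma frame_set s s' r v : 5 <= r <= 9 -> frame s s' -> frame s (set_reg s' r v).
Proof.
move=> r59 f r' r'59 /=; case: eqP => [e|_]; last exact: f.
by move: r'59; rewrite e r59.
Qed.

Definition hits (test : rel nat) (i j k : nat) := test k i || test k j.

Definition chosen (s : state) (k : nat) : bool := arr s k != 0.

Definition conflicts (test : rel nat) n (y : pred nat) i j : nat :=
  count (fun k => y k && hits test i j k) (iota 0 n).

Lemma wp_conflict test s :
  wp test conflict s 3 (fun s' => [/\ frame s s', reg s' 5 = reg s 5,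
    reg s' 6 = reg s 6, arr s' = arr s &
    (reg s' 8 != 0) = hits test (reg s 3) (reg s 4) (reg s 5)]).
Proof.
apply: (@wp_seq 1 2) => //; apply: wp_do => //.
apply: (@wp_seq 1 1) => //; apply: wp_do => //; apply: wp_do => //.
split => //=; first by do 3 apply: frame_set => //.
by rewrite /hits; do 2 case: (test _ _).
Qed.

Definition consts n s := [/\ reg s 0 = n, reg s 1 = 1 & reg s 10 = 0].

Lemma frame_consts n s s' : frame s s' -> consts n s -> consts n s'.
Proof. by move=> f [e0 e1 e10]; split; rewrite f. Qed.

Lemma wp_count_conflicts test n s : consts n s ->
  wp test count_conflicts s (n * 9 + 3) (fun s' => [/\ frame s s', arr s' = arr s &
    reg s' 6 = conflicts test n (chosen s) (reg s 3) (reg s 4)]).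
Proof.
move=> cs; apply: (@wp_seq 1 (n * 9 + 2)); [lia|apply: wp_do => //].
apply: (@wp_seq 1 (n * 9 + 1)); [lia|apply: wp_do => //].
set s0 := run_instr _ _ _.
pose P k := chosen s k && hits test (reg s 3) (reg s 4) k.
(* The loop runs downwards, so register 6 has counted the indices from k to n - 1. *)
pose Inv k s' := [/\ reg s' 5 = k, k <= n, frame s s', arr s' = arr s &
  reg s' 6 = count P (iota k (n - k))].
apply: (@wp_weaken _ _ _ (n * 9 + 1) _ (Inv 0)) => //.
  by move=> s' [_ _ f a c]; split => //; rewrite c subn0.
apply: wp_downto.
- move=> k s' [e _ f _ _]; split => //.
  by have [_ -> _] := frame_consts f cs.
- move=> k s' kn [e5 _ f a c].
  set s1 := set_reg s' 5 k.
  have f1 : frame s s1 by exact: frame_set.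
  apply: (@wp_seq 1 6) => //; apply: wp_do => //.
  set s2 := run_instr _ _ _.
  have f2 : frame s s2 by exact: frame_set.
  have cE : count P (iota k (n - k)) = P k + count P (iota k.+1 (n - k.+1)).
    by rewrite -[X in iota k X](subnSK kn).
  apply: wp_if; rewrite [reg s2 7]/= a => yk.
    apply: (@wp_seq 3 2) => //.
    apply: wp_weaken (wp_conflict test s2) => // s3 [f3 e5' e6' a3 h].
    have f13 : frame s s3 by move=> r rr; rewrite f3// f2.
    have h' : (reg s3 8 != 0) = P k.
      by rewrite h /P /chosen yk /s2 /= !f.
    apply: wp_if => [r8|/eqP r8]; apply: wp_do => //.
      split => //=; rewrite ?e5' ?a3//; first exact: ltnW.
        exact: frame_set.
      have [_ o _] := frame_consts f13 cs.
      by rewrite o e6' cE -h' r8 addnC /= c.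
    split => //=; rewrite ?e5' ?a3//; first exact: ltnW.
      exact: frame_set.
    by rewrite e6' cE -h' r8 /= c.
  apply: wp_do => //; split => //=; first exact: ltnW.
    exact: frame_set.
  by rewrite cE /P /chosen yk /= c.
have [e0 e1 e10] := cs.
have f0 : frame s s0 by apply: frame_set => //; exact: frame_set.
by split => //=; rewrite ?e0 ?e10 ?addn0 ?subnn.
Qed.

Lemma wp_swap test n s : consts n s ->
  wp test swap s (n * 7 + 4) (fun s' => frame s s' /\ forall x,
    chosen s' x = [|| x == reg s 3, x == reg s 4 |
      chosen s x && ~~ ((x < n) && hits test (reg s 3) (reg s 4) x)]).
Proof.
move=> cs; apply: (@wp_seq 1 (n * 7 + 3)); [lia|apply: wp_do => //].
apply: (@wp_seq (n * 7 + 1) 2); first by lia.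
set s0 := run_instr _ _ _.
pose H x := hits test (reg s 3) (reg s 4) x.
pose Inv k s' := [/\ reg s' 5 = k, frame s s' &
  forall x, chosen s' x = chosen s x && ~~ ((k <= x < n) && H x)].
have [e0 e1 e10] := cs.
apply: (@wp_weaken _ _ _ (n * 7 + 1) _ (Inv 0)) => //.
  move=> s' [_ f c]; have [_ o _] := frame_consts f cs.
  apply: (@wp_seq 1 1) => //; apply: wp_do => //; apply: wp_do => //; split => // x.
  rewrite /chosen /= o !f//; case: (x =P reg s 4) => [->|_] /=; first by rewrite orbT.
  by case: (x =P reg s 3) => [->|_] //=; exact: c.
apply: wp_downto.
- by move=> k s' [e f _]; split => //; have [_ -> _] := frame_consts f cs.
- move=> k s' kn [e5 f c].
  set s1 := set_reg s' 5 k.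
  have f1 : frame s s1 by exact: frame_set.
  apply: (@wp_seq 3 2) => //.
  apply: wp_weaken (wp_conflict test s1) => // s3 [f3 e5' e6' a3 h].
  have f13 : frame s s3 by move=> r rr; rewrite f3// f1.
  have h' : (reg s3 8 != 0) = H k by rewrite h /s1 /= !f.
  have cS x : (k <= x < n) && H x = ((x == k) && H k) || ((k < x < n) && H x).
    by rewrite leq_eqVlt eq_sym; case: eqP => [->|_] /=; rewrite ?kn// ltnn /= orbF.
  apply: wp_if => [r8|/eqP r8]; apply: wp_do => //; split => //=.
  + move=> x; rewrite /chosen /=; have [_ _ ->] := frame_consts f13 cs.
    rewrite e5' /= cS -h' r8 andbT; case: (x =P k) => _ /=; first by rewrite andbF.
    by rewrite a3; exact: c.
  + exact: frame_set.
  + move=> x; rewrite /chosen /= a3 cS -h' r8 andbF /=; exact: c.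
have f0 : frame s s0 by exact: frame_set.
split => //=; rewrite ?e0 ?e10 ?addn0//.
by move=> x; rewrite ltnNge andbN andbT.
Qed.

Definition improving test n y i j := ~~ test i j && (conflicts test n y i j < 2).

Lemma wp_try_swap test n s : consts n s ->
  wp test try_swap s (n * 16 + 11) (fun s' => frame s s' /\
    if improving test n (chosen s) (reg s 3) (reg s 4) then
      forall x, chosen s' x = [|| x == reg s 3, x == reg s 4 |
        chosen s x && ~~ ((x < n) && hits test (reg s 3) (reg s 4) x)]
    else arr s' = arr s).
Proof.
move=> cs; apply: (@wp_seq 1 (n * 16 + 9).+1); [lia|apply: wp_do => //].
set s1 := run_instr _ _ _.
have f1 : frame s s1 by exact: frame_set.
apply: wp_if => /= [t|t].
  apply: wp_do; [lia|split; first exact: frame_set].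
  by rewrite /improving; move: t; case: (test _ _).
have cs1 := frame_consts f1 cs.
apply: (@wp_seq (n * 9 + 3) (n * 7 + 6)); first by lia.
apply: wp_weaken (wp_count_conflicts test cs1) => // s2 [f2 a2 c2].
have f12 : frame s s2 by move=> r rr; rewrite f2// f1.
apply: (@wp_seq 1 (n * 7 + 4).+1); [lia|apply: wp_do => //].
set s3 := run_instr _ _ _.
have f3 : frame s s3 by exact: frame_set.
have [_ o _] := frame_consts f12 cs.
have -> : improving test n (chosen s) (reg s 3) (reg s 4) =
    (conflicts test n (chosen s) (reg s 3) (reg s 4) < 2).
  by rewrite /improving; move: t; case: (test _ _).
have r6 : (reg s3 6 == 0) = (conflicts test n (chosen s) (reg s 3) (reg s 4) < 2).
  by rewrite /= o c2 /= subn_eq0.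
apply: wp_if => [/negbTE r|/eqP r]; rewrite -r6 r.
  apply: wp_do; [lia|split; first exact: frame_set].
  by rewrite /= a2.
apply: wp_weaken (wp_swap test (frame_consts f3 cs)) => // s4 [f4 c4]; split.
  by move=> r' rr; rewrite f4// f3.
move=> x; rewrite c4 !f3//.
by congr [|| _, _ | _ && _]; rewrite /chosen /s3 /= a2.
Qed.

(** This mirrors what [swap] writes; cells from n on lie outside the erasing loop, hence the bound
    on k. *)
Definition swapped (test : rel nat) n (y : pred nat) i j : pred nat :=
  fun k => [|| k == i, k == j | y k && ~~ ((k < n) && hits test i j k)].

Definition independent (test : rel nat) n (y : pred nat) :=
  forall k l, k < n -> l < n -> y k -> y l -> test k l -> k = l.

Definition cardinal n (y : pred nat) := count y (iota 0 n).

Definition swap_optimal (test : rel nat) n (y : pred nat) :=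
  forall i j, i < n -> j < n -> ~~ improving test n y i j.

(** * Effect of a swap on independence and cardinality *)

Section local_search.
Context (test : rel nat) (n : nat).
Hypothesis test_refl : forall i, i < n -> test i i.
Hypothesis test_sym : symmetric test.

Lemma count_at_most_one (P : pred nat) j : (forall k, k < n -> P k -> k = j) ->
  count P (iota 0 n) <= 1.
Proof.
move=> Pj; rewrite -size_filter.
have u : uniq [seq k <- iota 0 n | P k] by rewrite filter_uniq// iota_uniq.
have := @uniq_leq_size _ _ [:: j] u; apply=> k.
by rewrite mem_filter mem_iota inE => /andP[Pk /= kn]; apply/eqP; exact: Pj.
Qed.

(** Survivors meet neither i nor j, and i and j do not meet; only a pair of survivors falls back on
    the old independence. *)
Lemma independent_swapped y i j : i < n -> j < n -> ~~ test i j ->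
  independent test n y -> independent test n (swapped test n y i j).
Proof.
move=> i_n j_n ij indep k l kn ln; rewrite /swapped kn ln /= /hits.
rewrite !negb_or ![test _ i]test_sym ![test _ j]test_sym.
case/or3P => [/eqP->|/eqP->|/and3P[yk /negPf ik /negPf jk]];
  case/or3P => [/eqP->|/eqP->|/and3P[yl /negPf il /negPf jl]] //.
- by rewrite (negPf ij).
- by rewrite il.
- by rewrite test_sym (negPf ij).
- by rewrite jl.
- by rewrite test_sym ik.
- by rewrite test_sym jk.
- exact: indep.
Qed.

(** The survivors contain neither i nor j, since each ball meets itself, and i differs from j, since
    they do not meet. So at most one ball is lost for two inserted, even if i or j was chosen
    before: it then counts as its own conflict. *)
Lemma cardinal_swapped y i j : i < n -> j < n -> improving test n y i j ->
  cardinal n y < cardinal n (swapped test n y i j).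
Proof.
move=> i_n j_n /andP[ij few].
pose kept k := y k && ~~ hits test i j k.
have -> : cardinal n y = conflicts test n y i j + count kept (iota 0 n).
  rewrite /cardinal /conflicts -count_predUI [X in _ + X](@eq_count _ _ pred0); last first.
    by move=> k /=; rewrite /kept; case: (y k); case: (hits _ _ _ _).
  rewrite count_pred0 addn0; apply: eq_count => k /=.
  by rewrite /kept; case: (y k); case: (hits _ _ _ _).
have ij' : i != j by apply: contraNneq ij => <-; exact: test_refl.
have -> : cardinal n (swapped test n y i j) =
    count (pred1 i) (iota 0 n) + (count (pred1 j) (iota 0 n) + count kept (iota 0 n)).
  rewrite /cardinal -[X in _ = _ + X]count_predUI.
  rewrite [X in _ = _ + (_ + X)](@eq_count _ _ pred0); last first.
    move=> k /=; case: eqP => //= ->.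
    by rewrite /kept /hits test_refl// orbT andbF.
  rewrite count_pred0 addn0 -count_predUI [X in _ = _ + X](@eq_count _ _ pred0); last first.
    move=> k /=; case: eqP => //= ->.
    by rewrite (negPf ij') /kept /hits test_refl// andbF.
  rewrite count_pred0 addn0; apply: eq_in_count => k; rewrite mem_iota /= => kn.
  by rewrite /swapped kn.
rewrite !count_uniq_mem ?iota_uniq// !mem_iota /= !add0n i_n j_n /=.
by move: few; lia.
Qed.

(** * Loop invariants *)

Lemma cardinal_le y : cardinal n y <= n.
Proof. by rewrite -[leqRHS](size_iota 0 n) count_size. Qed.

(** Nonemptiness is carried along because the domination argument pairs a ball with some chosen
    one. *)
Definition good s :=
  [/\ consts n s, independent test n (chosen s) & 0 < n -> 0 < cardinal n (chosen s)].

(** Both counters run downwards, so the pairs from (i, j) on in lexicographic order are those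
    already scanned. *)
Definition after i j i' j' := (i < i') || ((i == i') && (j <= j')).

Definition scanned (y : pred nat) i j :=
  forall i' j', i' < n -> j' < n -> after i j i' j' -> ~~ improving test n y i' j'.

(* After q completed rounds the set is optimal or has more than q elements.  In
   the middle of a round, either it has gained an element or no pair scanned so
   far is improving. *)
Definition progress q y i j :=
  (swap_optimal test n y \/ q < cardinal n y) /\ (scanned y i j \/ q.+1 < cardinal n y).

Definition outer_inv r s := [/\ reg s 2 = r, r <= n, good s &
  swap_optimal test n (chosen s) \/ n - r < cardinal n (chosen s)].

(** During a round register 2 is already decremented: r rounds follow the current one and n - r.+1
    are complete. *)
Definition middle_inv r i s := [/\ reg s 2 = r, reg s 3 = i, i <= n, good s &
  progress (n - r.+1) (chosen s) i 0].

Definition inner_inv r i j s :=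
  [/\ reg s 2 = r, reg s 3 = i, reg s 4 = j, j <= n &
  good s /\ progress (n - r.+1) (chosen s) i j].

Lemma inner_step r i j s : r < n -> i < n -> j < n -> inner_inv r i j.+1 s ->
  wp test try_swap (set_reg s 4 j) (n * 16 + 11) (inner_inv r i j).
Proof.
move=> rn i_n jn [e2 e3 e4 _ [[cs indep pos] [opt scan]]].
set s1 := set_reg s 4 j.
have cs1 : consts n s1 by [].
apply: wp_weaken (wp_try_swap test cs1) => // s' [f].
have c1 : chosen s1 = chosen s by [].
rewrite /inner_inv /good c1 (_ : reg s1 3 = i)// (_ : reg s1 4 = j)//.
have r2 : reg s' 2 = r by rewrite f.
have r3 : reg s' 3 = i by rewrite f.
have r4 : reg s' 4 = j by rewrite f.
have cs' := frame_consts f cs1.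
case: ifPn => [imp c'|imp a'].
  have -> : chosen s' = swapped test n (chosen s) i j by apply/funext => x; rewrite c'.
  have lt := cardinal_swapped i_n jn imp.
  (* An improving pair refutes optimality, so the set had more than n - r.+1 elements already and
     the swap adds at least one. *)
  have qlt : n - r.+1 < cardinal n (chosen s).
    by case: opt => // /(_ i j i_n jn); rewrite imp.
  split => //; [exact: ltnW|split; [split => //|split; right; lia]].
    by apply: independent_swapped => //; case/andP: imp.
  by move=> _; lia.
have ch : chosen s' = chosen s by rewrite /chosen a'.
rewrite ch; split => //; first exact: ltnW.
split; [split => //|split => //]; case: scan => [scan|]; last by right.
left => i' j' i'n j'n; rewrite /after => /orP[ii|/andP[/eqP ii]].
  by apply: scan => //; rewrite /after ii.
rewrite leq_eqVlt => /orP[/eqP <-|jj]; first by rewrite -ii.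
by apply: scan => //; rewrite /after ii eqxx jj orbT.
Qed.

Lemma middle_step r i s : r < n -> i < n -> middle_inv r i.+1 s ->
  wp test (Seq (Do (Add 4 0 10)) (downto 4 try_swap)) (set_reg s 3 i)
    (n * (n * 16 + 13) + 2) (middle_inv r i).
Proof.
move=> rn i_n [e2 e3 _ [cs indep pos] [opt scan]].
have [e0 e1 e10] := cs.
apply: (@wp_seq 1 (n * (n * 16 + 13) + 1)); [lia|apply: wp_do => //].
set s1 := run_instr _ _ _.
(* Indices stay below n, so the pairs from (i, n) on are those from (i + 1, 0) on. *)
have start : inner_inv r i n s1.
  split => //=; first by rewrite e0 e10 addn0.
  split; [split => //|split => //]; case: scan => [scan|]; last by right.
  left => i' j' i'n j'n; rewrite /after [n <= j']leqNgt j'n andbF orbF => ii.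
  by apply: scan => //; rewrite /after leq0n andbT orbC -leq_eqVlt.
apply: wp_weaken (wp_downto (T := n * 16 + 11) _ _ start) => //.
- lia.
- by move=> s' [e2' e3' _ _ [g p]]; split => //; exact: ltnW.
- by move=> k s' [_ _ -> _ [[[_ -> _] _ _] _]].
- by move=> k s' kn inv; apply: inner_step.
Qed.

Lemma outer_step r s : r < n -> outer_inv r.+1 s ->
  wp test (Seq (Do (Add 3 0 10))
      (downto 3 (Seq (Do (Add 4 0 10)) (downto 4 try_swap)))) (set_reg s 2 r)
    (n * (n * (n * 16 + 13) + 4) + 2) (outer_inv r).
Proof.
move=> rn [e2 _ [cs indep pos] opt].
have [e0 e1 e10] := cs.
apply: (@wp_seq 1 (n * (n * (n * 16 + 13) + 4) + 1)); [lia|apply: wp_do => //].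
set s1 := run_instr _ _ _.
have start : middle_inv r n s1.
  split => //=; first by rewrite e0 e10 addn0.
  split => //; left => i' j' i'n j'n; rewrite /after.
  by case: ltngtP i'n.
apply: wp_weaken (wp_downto (T := n * (n * 16 + 13) + 2) _ _ start) => //.
- lia.
- move=> s' [e2' _ _ g [opt' scan]]; split => //; first exact: ltnW.
  (* A complete scan without improving pair is optimality; otherwise the round has gained an
     element. *)
  case: scan => [scan|]; last by rewrite subnSK//; right.
  left => i' j' i'n j'n; apply: scan => //; rewrite /after leq0n andbT.
  by case: i' {i'n}.
- by move=> k s' [_ -> _ [[_ -> _] _ _] _].
- by move=> k s' kn inv; apply: middle_step.
Qed.

Lemma wp_local_search :
  wp test local_search (initial n) (n * (n * (n * (n * 16 + 13) + 4) + 4) + 4)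
    (fun s => good s /\ swap_optimal test n (chosen s)).
Proof.
set N := n * (n * (n * 16 + 13) + 4) + 2.
apply: (@wp_seq 1 (n * N.+2 + 3)); [lia|apply: wp_do => //].
apply: (@wp_seq 1 (n * N.+2 + 2)); [lia|apply: wp_do => //].
apply: (@wp_seq 1 (n * N.+2 + 1)); [lia|apply: wp_do => //].
set s := run_instr _ _ _.
have ch : chosen s = pred1 0 by apply/funext => -[|x].
have start : outer_inv n s.
  have card : 0 < n -> 0 < cardinal n (chosen s).
    by move=> n0; rewrite ch /cardinal count_uniq_mem ?iota_uniq// mem_iota /= add0n n0.
  have cs : consts n s by [].
  split => //=; first by rewrite addn0.
    split=> [//||]; last exact: card.
    by rewrite ch => k l _ _ /eqP -> /eqP ->.
  rewrite subnn; case: (posnP n) => [n0|n0]; last by right; exact: card.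
  by left => i j; rewrite n0.
apply: wp_weaken (wp_downto (T := N) _ _ start) => //.
(* After n rounds the alternative to optimality is more than n chosen indices below n, which is
   absurd. *)
- move=> s' [_ _ g [//|]]; rewrite subn0 => lt.
  by have := cardinal_le (chosen s'); lia.
- by move=> k s' [-> _ [[_ -> _] _ _] _].
- by move=> k s' kn inv; apply: outer_step.
Qed.

(* Pairing an undominated i with any chosen j would be an improving swap, so
   maximality needs no separate test. *)
Lemma swap_optimal_dominating y : independent test n y -> (0 < n -> 0 < cardinal n y) ->
  swap_optimal test n y -> forall i, i < n -> exists k, [/\ k < n, y k & test i k].
Proof.
move=> indep pos opt i i_n.
have := pos (leq_ltn_trans (leq0n i) i_n).
rewrite /cardinal -has_count => /hasP[j]; rewrite mem_iota /= => jn yj.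
apply: contrapT => none.
have nt k : k < n -> y k -> ~~ test i k by move=> kn yk; apply/negP => t; apply: none; exists k.
have := opt i j i_n jn; rewrite /improving (nt j)//= => /negP; apply.
apply: (@count_at_most_one _ j) => k kn /andP[yk].
rewrite /hits test_sym (negPf (nt k kn yk)) /= => t; exact: indep.
Qed.

(** If i and i' were disjoint, inserting both would conflict with j at most, an improving swap. *)
Lemma swap_optimal_private y : swap_optimal test n y ->
  forall i i' j, i < n -> i' < n ->
  (forall k, k < n -> y k -> test i k -> k = j) ->
  (forall k, k < n -> y k -> test i' k -> k = j) -> test i i'.
Proof.
move=> opt i i' j i_n i'n ij i'j; apply: contraT => t.
have := opt i i' i_n i'n; rewrite /improving t /= => /negP; case.
apply: (@count_at_most_one _ j) => k kn /andP[yk].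
by rewrite /hits !(test_sym k) => /orP[]; [exact: ij|exact: i'j].
Qed.

End local_search.

Local Close Scope nat_scope.
Local Open Scope classical_set_scope.
Local Open Scope ring_scope.

(** * Prekopa-Leindler inequality on the line *)

Lemma measurable_affine (R : realType) (a b : R) :
  measurable_fun setT (fun x : measurableTypeR R => a * x + b : measurableTypeR R).
Proof.
by apply: measurable_funD => //; apply: measurable_funM.
Qed.

(** The measure of preimages, scaled by |a|, has the right mass on half-open intervals, and these
    determine Lebesgue measure. A negative a exchanges the open and the closed end. *)
Lemma lebesgue_measure_affine (R : realType) (a b : R) (A : set R) :
  a != 0 -> measurable (A : set (measurableTypeR R)) ->
  lebesgue_measure ((fun x => a * x + b) @^-1` A) =
  (`|a|^-1%:E * lebesgue_measure A)%E.
Proof.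
move=> a0 mA.
have na0 : 0 < `|a| by rewrite normr_gt0.
pose phi : measurableTypeR R -> measurableTypeR R := fun x => a * x + b.
pose m : {measure set (measurableTypeR R) -> \bar R} :=
  mscale (NngNum (normr_ge0 a)) (measure_function_pushforward__canonical__measure_function_Measure
    (@lebesgue_measure R) (measurable_affine a b)).
have mE X : m X = (`|a|%:E * lebesgue_measure (phi @^-1` X))%E by [].
have -> : lebesgue_measure A = m A.
  apply: lebesgue_measure_unique => // _ [[u v]] _ <-.
  rewrite mE /phi.
  have [a_lt|a_gt|/eqP] := ltgtP a 0; last by rewrite (negPf a0).
  - rewrite (_ : _ @^-1` _ = `[(v - b) / a, (u - b) / a[%classic); last first.
      apply/seteqP; split => x /=; rewrite !in_itv /= ler_ndivrMr// ltr_ndivlMr//;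
        by rewrite ltrBlDr lerBrDr ![x * a]mulrC andbC.
    rewrite !lebesgue_measure_itv /= !lte_fin ltr_ndivlMr// divfK// ltrBrDr subrK.
    case: ifP => [uv|_]; last by rewrite mule0.
    by rewrite -EFinM ltr0_norm//; congr EFin; field.
  - rewrite (_ : _ @^-1` _ = `](u - b) / a, (v - b) / a]%classic); last first.
      apply/seteqP; split => x /=; rewrite !in_itv /= ltr_pdivrMr// ler_pdivlMr//;
        by rewrite ltrBlDr lerBrDr ![x * a]mulrC.
    rewrite !lebesgue_measure_itv /= !lte_fin ltr_pdivlMr// divfK// ltrBrDr subrK.
    case: ifP => [uv|_]; last by rewrite mule0.
    by rewrite -EFinM gtr0_norm//; congr EFin; field.
by rewrite mE muleA -EFinM mulVf ?gt_eqF// mul1e.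
Qed.

Lemma ge0_integral_affine (R : realType) (a b : R) (f : R -> \bar R) :
  a != 0 -> measurable_fun [set: R] f ->
  (forall x, (0 <= f x)%E) ->
  (\int[lebesgue_measure]_x f (a * x + b)%R =
   `|a|^-1%:E * \int[lebesgue_measure]_x f x)%E.
Proof.
move=> a0 mf f0.
pose phi : measurableTypeR R -> measurableTypeR R := fun x => a * x + b.
have := @ge0_integral_pushforward _ _ _ _ R phi (@measurable_affine R a b)
  lebesgue_measure setT f measurableT mf (fun x _ => f0 x).
rewrite preimage_setT => <-.
have ia0 : 0 <= `|a|^-1 by rewrite invr_ge0.
rewrite -[X in (X%:E * _)%E]/(NngNum ia0)%:num -ge0_integral_mscale//.
apply: eq_measure_integral => [|mphi A mA _]; first exact: measurable_affine.
exact: lebesgue_measure_affine.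
Qed.

(** One-dimensional Brunn-Minkowski: take a near the top of A and b near the bottom of B. Midpoints
    of b with the part of A below a lie left of (a + b) / 2, midpoints of a with the part of B from
    b on do not. So C contains disjoint half-size copies of A and B up to a loss of e. *)
Lemma midpoint_measure (R : realType) (A B C : set R) :
  measurable A -> measurable B -> measurable C -> A !=set0 -> B !=set0 ->
  has_ubound A -> has_lbound B ->
  (forall a b, A a -> B b -> C ((a + b) / 2)) ->
  (lebesgue_measure A + lebesgue_measure B <= 2%:E * lebesgue_measure C)%E.
Proof.
move=> mA mB mC A0 B0 ubA lbB ABC; apply/lee_addgt0Pr => e e0.
have e20 : 0 < e / 2 by rewrite divr_gt0.
have [a Aa supa] := sup_adherent e20 (conj A0 ubA).
have [b Bb infb] := inf_adherent e20 (conj B0 lbB).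
pose A1 := A `&` `]-oo, a[; pose B1 := B `&` `[b, +oo[.
have mA1 : measurable A1 by apply: measurableI => //; exact: measurable_itv.
have mB1 : measurable B1 by apply: measurableI => //; exact: measurable_itv.
have lA : (lebesgue_measure A <= lebesgue_measure A1 + (e / 2)%:E)%E.
  have <- : lebesgue_measure (`[a, a + e / 2] : set R) = (e / 2)%:E.
    rewrite lebesgue_measure_itv /= lte_fin ltrDl e20.
    by rewrite -EFinD addrAC subrr add0r.
  apply: (le_trans _ (measureU2 _ _ _)) => //.
  apply: le_measure; rewrite ?inE//; first exact: measurableU.
  move=> x Ax; have [xa|ax] := ltP x a; [left|right] => /=.
    by split => //=; rewrite in_itv.
  rewrite in_itv /= ax /=; have := ub_le_sup ubA Ax.
  by move: supa; lra.
have lB : (lebesgue_measure B <= lebesgue_measure B1 + (e / 2)%:E)%E.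
  have <- : lebesgue_measure (`[b - e / 2, b] : set R) = (e / 2)%:E.
    rewrite lebesgue_measure_itv /= lte_fin ltrBlDr ltrDl e20.
    by rewrite -EFinD opprB addrC subrK.
  apply: (le_trans _ (measureU2 _ _ _)) => //.
  apply: le_measure; rewrite ?inE//; first exact: measurableU.
  move=> x Bx; have [xb|bx] := leP b x; [left|right] => /=.
    by split => //=; rewrite in_itv /= xb.
  rewrite in_itv /= (ltW bx) andbT; have := ge_inf lbB Bx.
  by move: infb; lra.
have two0 : (2 : R) != 0 by [].
have mpre (D : set R) c : measurable D -> measurable ((fun x => 2 * x + c) @^-1` D).
  move=> mD; rewrite -[X in measurable X]setTI; exact: (@measurable_affine R 2 c).
(* The midpoints of A1 with b and of a with B1, written as preimages so that affine scaling
   applies. *)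
pose U := (fun x => 2 * x + - b) @^-1` A1; pose V := (fun x => 2 * x + - a) @^-1` B1.
have UV : (lebesgue_measure U + lebesgue_measure V <= lebesgue_measure C)%E.
  rewrite -measureU; [|exact: mpre..|].
    apply: le_measure; rewrite ?inE//; first by apply: measurableU; exact: mpre.
    move=> x [[/= Ax _]|[/= Bx _]].
      by rewrite (_ : x = (2 * x - b + b) / 2); [exact: ABC|lra].
    by rewrite (_ : x = (a + (2 * x - a)) / 2); [exact: ABC|lra].
  apply/seteqP; split => // x [[_ /=] + [_ /=]].
  by rewrite !in_itv /=; lra.
move: UV; rewrite !lebesgue_measure_affine// gtr0_norm// -ge0_muleDr//.
have h0 : (0 < (2 : R)%:E)%E by [].
rewrite -(lee_pmul2l _ h0)// muleA -EFinM divff// mul1e => UV.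
apply: (le_trans (leeD lA lB)); rewrite addeACA -EFinD.
rewrite (_ : e / 2 + e / 2 = e); last by lra.
by rewrite leeD2r.
Qed.

(** Tonelli on the region under the graph: its vertical sections have measure h x, its horizontal
    ones are the superlevel sets. *)
Lemma layer_cake d (T : measurableType d) (R : realType)
    (mu : {sigma_finite_measure set T -> \bar R}) (h : T -> \bar R) :
  measurable_fun setT h -> (forall x, 0 <= h x)%E ->
  measurable_fun (`[0, +oo[ : set R) (fun t => mu [set x | (t%:E < h x)%E]) /\
  (\int[mu]_x h x =
   \int[lebesgue_measure]_(t in (`[0%R, +oo[ : set R)) mu [set x | (t%:E < h x)%E])%E.
Proof.
move=> mh h0.
pose G : set (T * measurableTypeR R) := [set p | 0 <= p.2 /\ (p.2%:E < h p.1)%E].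
have mG : measurable G.
  rewrite (_ : G = [set p | 0 <= p.2] `&` [set p | (p.2%:E < h p.1)%E])//.
  have msnd : measurable_fun setT (snd : T * measurableTypeR R -> measurableTypeR R).
    exact: measurable_snd.
  apply: measurableI.
    have := msnd measurableT `[0, +oo[%classic (measurable_itv _).
    rewrite setTI (_ : _ @^-1` _ = [set p | 0 <= p.2])//.
    by apply/seteqP; split => p /=; rewrite in_itv /= andbT.
  rewrite -[X in measurable X]setTI; apply: measurable_lte => //.
    by apply/measurable_EFinP.
  by apply: measurableT_comp => //; exact: measurable_fst.
have yG t : 0 <= t -> ysection G t = [set x | (t%:E < h x)%E].
  move=> t0; apply/seteqP; split => x; rewrite /ysection /= inE /G /=; last by split.
  by case.
split.
  apply: (eq_measurable_fun ((mu : {sigma_finite_measure set T -> \bar R}) \o ysection G)).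
    by move=> t; rewrite inE /= in_itv /= andbT => t0; rewrite yG.
  by apply: measurable_funTS; exact: measurable_fun_ysection.
transitivity ((mu \x @lebesgue_measure R)%E G).
  apply: eq_integral => x _ /=; have := h0 x.
  rewrite (_ : xsection G x = [set t | 0 <= t /\ (t%:E < h x)%E]); last first.
    by apply/seteqP; split => t; rewrite /xsection /= inE.
  case: (h x) => [r| |]//.
    rewrite lee_fin => r0; rewrite (_ : [set _ | _] = `[0, r[%classic); last first.
      apply/seteqP; split => t /=; rewrite in_itv /= lte_fin; first by case=> -> ->.
      by move=> /andP.
    rewrite lebesgue_measure_itv /= lte_fin; case: ltgtP r0 => // [_ _|<-]; rewrite ?ltxx//.
    by rewrite -EFinD subr0.
  move=> _; rewrite (_ : [set _ | _] = `[0, +oo[%classic); last first.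
    apply/seteqP; split => t /=; rewrite in_itv /= andbT; first by case.
    by rewrite ltry.
  by rewrite lebesgue_measure_itv /= ltry.
transitivity ((mu \x^ @lebesgue_measure R)%E G).
  apply: (product_measure_unique (m' := (mu \x^ @lebesgue_measure R)%E)) => //= A1 A2 mA1 mA2.
  exact: product_measure2E.
(* Below height 0 the horizontal sections are empty, so restricting to [0, +oo[ loses nothing. *)
rewrite /product_measure2 [RHS]integral_mkcond; apply: eq_integral => t _.
rewrite patchE; case: ifPn => [|]; rewrite ?inE ?notin_setE /= in_itv /= andbT.
  by move=> t0; rewrite yG.
move=> /negP/negP t0; rewrite (_ : ysection G t = set0) ?measure0//.
by apply/seteqP; split => // x; rewrite /ysection /= inE => -[t0']; rewrite t0' in t0.
Qed.

Local Open Scope ereal_scope.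

(* The superlevel sets at any height t < 1 are nonempty, so the one-dimensional
   Brunn-Minkowski inequality applies to each of them. *)
Lemma prekopa_leindler_normalized (R : realType) (f g : R -> R) (h : R -> \bar R) (M : R) :
  measurable_fun setT f -> measurable_fun setT g -> measurable_fun setT h ->
  (forall x, 0 <= f x <= 1)%R -> (forall x, 0 <= g x <= 1)%R ->
  (forall x, 0 <= h x) ->
  (forall x, 0 < f x -> `|x| <= M)%R -> (forall x, 0 < g x -> `|x| <= M)%R ->
  (forall t, t < 1 -> exists x, t < f x)%R ->
  (forall t, t < 1 -> exists x, t < g x)%R ->
  (forall x y, (f x * g y)%:E <= h ((x + y) / 2)%R * h ((x + y) / 2)%R) ->
  \int[lebesgue_measure]_x (f x)%:E + \int[lebesgue_measure]_x (g x)%:E <=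
  2%:E * \int[lebesgue_measure]_x h x.
Proof.
move=> mf mg mh f01 g01 h0 fM gM f1 g1 fgh.
have mf' : measurable_fun [set: R] (EFin \o f) by apply/measurable_EFinP.
have mg' : measurable_fun [set: R] (EFin \o g) by apply/measurable_EFinP.
have f0 x : 0 <= (EFin \o f) x by rewrite /= lee_fin; case/andP: (f01 x).
have g0 x : 0 <= (EFin \o g) x by rewrite /= lee_fin; case/andP: (g01 x).
have [mlf ->] := layer_cake (@lebesgue_measure R) mf' f0.
have [mlg ->] := layer_cake (@lebesgue_measure R) mg' g0.
have [mlh ->] := layer_cake (@lebesgue_measure R) mh h0.
have mI : measurable (`[0%R, +oo[ : set R) by exact: measurable_itv.
rewrite -ge0_integralD// -ge0_integralZl//.
apply: ge0_le_integral => //.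
- by move=> t _; apply: adde_ge0; exact: measure_ge0.
- exact: emeasurable_funD.
- by apply: measurable_funeM.
move=> t /=; rewrite in_itv /= andbT => t0.
have mlt (u : R -> \bar R) : measurable_fun [set: R] u ->
    measurable [set x | t%:E < u x].
  by move=> mu; rewrite -[X in measurable X]setTI; apply: measurable_lte.
have [t1|t1] := ltP t 1%R; last first.
  have empty (u : R -> R) : (forall x, 0 <= u x <= 1)%R ->
      [set x | t%:E < (EFin \o u) x] = set0.
    move=> u01; apply/seteqP; split => // x /=; rewrite lte_fin ltNge.
    by rewrite (le_trans _ t1)//; case/andP: (u01 x).
  by rewrite !empty// measure0 add0e mule_ge0.
apply: midpoint_measure; [exact: mlt..| | | | |].
- by have [x fx] := f1 t t1; exists x; rewrite /= lte_fin.
- by have [x gx] := g1 t t1; exists x; rewrite /= lte_fin.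
- exists M => x /=; rewrite lte_fin => tf.
  by rewrite (le_trans (ler_norm x))// fM// (le_lt_trans t0).
- exists (- M)%R => x /=; rewrite lte_fin => tg.
  by rewrite lerNl (le_trans _ (gM x _))// ?ler_normr ?lexx ?orbT// (le_lt_trans t0).
move=> x y /=; rewrite !lte_fin => tf tg.
(* If h were at most t at the midpoint, its square would be at most t^2, which is below f x * g
   y. *)
rewrite ltNge; apply/negP => ht.
have := fgh x y; rewrite leNgt => /negP; apply.
apply: (@le_lt_trans _ _ (t%:E * t%:E)); first by apply: lee_pmul.
by rewrite -EFinM lte_fin; nra.
Qed.

(** Dividing f and g by their suprema a and b, and h by sqrt (a b), keeps the hypothesis and yields
    the additive inequality; the arithmetic-geometric mean inequality turns it into a product. *)
Lemma prekopa_leindler_bounded (R : realType) (f g : R -> R) (h : R -> \bar R) (M : R) :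
  measurable_fun setT f -> measurable_fun setT g -> measurable_fun setT h ->
  (forall x, 0 <= f x <= M)%R -> (forall x, 0 <= g x <= M)%R ->
  (forall x, 0 <= h x) ->
  (forall x, 0 < f x -> `|x| <= M)%R -> (forall x, 0 < g x -> `|x| <= M)%R ->
  (forall x y, (f x * g y)%:E <= h ((x + y) / 2)%R * h ((x + y) / 2)%R) ->
  (\int[lebesgue_measure]_x (f x)%:E) * (\int[lebesgue_measure]_x (g x)%:E) <=
  (\int[lebesgue_measure]_x h x) * (\int[lebesgue_measure]_x h x).
Proof.
move=> mf mg mh fb gb h0 fM gM fgh.
have sup_le (u : R -> R) : (forall x, 0 <= u x <= M)%R -> has_sup (range u).
  move=> ub; split; first by exists (u 0%R); exists 0%R.
  by exists M => _ [x _ <-]; case/andP: (ub x).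
have F0 : 0 <= \int[lebesgue_measure]_x (f x)%:E.
  by apply: integral_ge0 => x _; rewrite lee_fin; case/andP: (fb x).
have G0 : 0 <= \int[lebesgue_measure]_x (g x)%:E.
  by apply: integral_ge0 => x _; rewrite lee_fin; case/andP: (gb x).
have H0 : 0 <= \int[lebesgue_measure]_x h x.
  by apply: integral_ge0 => x _.
have zero (u : R -> R) : (forall x, 0 <= u x <= M)%R -> (sup (range u) <= 0)%R ->
    \int[lebesgue_measure]_x (u x)%:E = 0.
  move=> ub su; apply: integral0_eq => x _; congr EFin.
  apply/eqP; rewrite eq_le; case/andP: (ub x) => -> _; rewrite andbT.
  by apply: le_trans su; apply: ub_le_sup; [case: (sup_le _ ub)|exists x].
(* A function with supremum at most 0 integrates to 0; past this point both suprema are positive. *)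
have [a0|a0] := leP (sup (range f)) 0%R; first by rewrite (zero f)// mul0e mule_ge0.
have [b0|b0] := leP (sup (range g)) 0%R; first by rewrite (zero g)// mule0 mule_ge0.
set a := sup (range f) in a0; set b := sup (range g) in b0.
pose s := Num.sqrt (a * b).
have s2 : (s * s = a * b)%R by rewrite -expr2 sqr_sqrtr// mulr_ge0// ltW.
have s0 : (0 < s)%R by rewrite sqrtr_gt0 mulr_gt0.
have unit (u : R -> R) c : (forall x, 0 <= u x <= M)%R -> (0 < c)%R ->
    c = sup (range u) -> (forall x, 0 <= c^-1 * u x <= 1)%R /\
    (forall t, t < 1 -> exists x, t < c^-1 * u x)%R.
  move=> ub c0 cE; split => [x|t t1].
    case/andP: (ub x) => u0 _; rewrite mulr_ge0 ?invr_ge0 ?(ltW c0)//=.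
    rewrite mulrC ler_pdivrMr// mul1r cE.
    by apply: ub_le_sup; [case: (sup_le _ ub)|exists x].
  have e0 : (0 < c * (1 - t))%R by rewrite mulr_gt0// subr_gt0.
  have [_ [x _ <-] ux] := sup_adherent e0 (sup_le _ ub); exists x.
  rewrite mulrC ltr_pdivlMr//; move: ux; rewrite -cE; lra.
have [f01 f1] := unit f a fb a0 erefl.
have [g01 g1] := unit g b gb b0 erefl.
have pos (u : R -> R) c x : (0 < c)%R -> (0 < c^-1 * u x)%R -> (0 < u x)%R.
  by move=> c0; rewrite pmulr_rgt0// invr_gt0.
have is0 : 0 <= (s^-1)%:E by rewrite lee_fin invr_ge0 ltW.
have mf' : measurable_fun [set: R] (EFin \o f) by apply/measurable_EFinP.
have mg' : measurable_fun [set: R] (EFin \o g) by apply/measurable_EFinP.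
have f0 x : 0 <= (f x)%:E by rewrite lee_fin; case/andP: (fb x).
have g0 x : 0 <= (g x)%:E by rewrite lee_fin; case/andP: (gb x).
have ia0 : 0 <= (a^-1)%:E by rewrite lee_fin invr_ge0 ltW.
have ib0 : 0 <= (b^-1)%:E by rewrite lee_fin invr_ge0 ltW.
have : (a^-1)%:E * \int[lebesgue_measure]_x (f x)%:E +
    (b^-1)%:E * \int[lebesgue_measure]_x (g x)%:E <=
    2%:E * ((s^-1)%:E * \int[lebesgue_measure]_x h x).
  rewrite -[X in X + _]ge0_integralZl//; first rewrite -[X in _ + X]ge0_integralZl//;
    first rewrite -[X in _ <= _ * X]ge0_integralZl//.
  apply: (@prekopa_leindler_normalized R (fun x => a^-1 * f x)%R
      (fun x => b^-1 * g x)%R (fun x => (s^-1)%:E * h x) M) => //.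
  - exact: measurable_funM.
  - exact: measurable_funM.
  - exact: measurable_funeM.
  - by move=> x; rewrite mule_ge0.
  - by move=> x /(pos _ _ _ a0); exact: fM.
  - by move=> x /(pos _ _ _ b0); exact: gM.
  - move=> x y; rewrite muleACA -EFinM.
      rewrite (_ : s^-1 * s^-1 = a^-1 * b^-1)%R; last by rewrite -!invfM s2.
      rewrite (_ : a^-1 * f x * (b^-1 * g y) = (a^-1 * b^-1) * (f x * g y))%R; last ring.
      by rewrite EFinM lee_pmul2l// lte_fin mulr_gt0// invr_gt0.
(* If the integral of h is infinite nothing remains to prove; if it is finite, the additive
   inequality makes the other two finite. *)
move: F0 G0 H0; move: (\int[lebesgue_measure]_x h x) (\int[lebesgue_measure]_x (f x)%:E)
  (\int[lebesgue_measure]_x (g x)%:E) => [H| |] F G F0 G0 H0 //; last first.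
  by move=> _; rewrite mulyy leey.
have ay : (a^-1)%:E * +oo = +oo by rewrite gt0_muley// lte_fin invr_gt0.
have by' : (b^-1)%:E * +oo = +oo by rewrite gt0_muley// lte_fin invr_gt0.
case: F F0 => [F| |]// F0; case: G G0 => [G| |]// G0;
  rewrite ?ay ?by' -?EFinM ?addey ?addye// -EFinD !lee_fin in F0 G0 * => le2.
have : ((a^-1 * F) * (b^-1 * G) <= (s^-1 * H) * (s^-1 * H))%R.
  set u := (a^-1 * F)%R in le2 *; set v := (b^-1 * G)%R in le2 *.
  have u0 : (0 <= u)%R by rewrite mulr_ge0// invr_ge0 ltW.
  have v0 : (0 <= v)%R by rewrite mulr_ge0// invr_ge0 ltW.
  by have := sqr_ge0 (u - v)%R; nra.
rewrite mulrACA [X in (_ <= X)%R -> _]mulrACA -!invfM s2 ler_pM2l//.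
by rewrite invr_gt0 mulr_gt0.
Qed.

(** Cutting at height n and outside [-n, n] meets both boundedness hypotheses of
    [prekopa_leindler_bounded] with one constant. *)
Definition truncation (R : realType) (u : R -> \bar R) (n : nat) (x : R) : R :=
  (fine (mine (u x) n%:R%:E) * \1_(`[- n%:R, n%:R] : set R) x)%R.

Lemma fine_mineK (R : realType) (y : \bar R) n :
  0 <= y -> (fine (mine y n%:R%:E))%:E = mine y n%:R%:E.
Proof.
move=> y0; apply: fineK; rewrite ge0_fin_numE; last by rewrite le_min y0 lee_fin ler0n.
by rewrite gt_min ltry orbT.
Qed.

Lemma truncationE (R : realType) (u : R -> \bar R) n x : 0 <= u x ->
  (truncation u n x)%:E = if (`|x| <= n%:R)%R then mine (u x) n%:R%:E else 0.
Proof.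
move=> u0; rewrite /truncation indicE; case: ifPn => xn.
  by rewrite mem_set ?mulr1 ?fine_mineK//= in_itv /= -ler_norml.
by rewrite memNset ?mulr0//= in_itv /= -ler_norml; exact/negP.
Qed.

Lemma truncation_bound (R : realType) (u : R -> \bar R) n x : 0 <= u x ->
  (0 <= truncation u n x <= n%:R)%R.
Proof.
move=> u0; rewrite -!lee_fin truncationE//; case: ifP => _.
  by rewrite le_min u0 lee_fin ler0n ge_min lexx orbT.
by rewrite lexx lee_fin ler0n.
Qed.

Lemma truncation_support (R : realType) (u : R -> \bar R) n x : 0 <= u x ->
  (0 < truncation u n x)%R -> (`|x| <= n%:R)%R.
Proof. by move=> u0; rewrite -lte_fin truncationE//; case: ifP; rewrite ?ltxx. Qed.

Lemma truncation_le (R : realType) (u : R -> \bar R) n x : 0 <= u x ->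
  (truncation u n x)%:E <= u x.
Proof. by move=> u0; rewrite truncationE//; case: ifP => // _; rewrite ge_min lexx. Qed.

Lemma measurable_truncation (R : realType) (u : R -> \bar R) n :
  measurable_fun [set: R] u -> measurable_fun [set: R] (truncation u n).
Proof.
move=> mu; apply: measurable_funM.
  by apply: measurableT_comp; [exact: fine_measurable|exact: measurable_mine].
by apply: measurable_indic; exact: measurable_itv.
Qed.

Lemma truncation_nd (R : realType) (u : R -> \bar R) x : 0 <= u x ->
  {homo (fun n => (truncation u n x)%:E) : m n / (m <= n)%N >-> m <= n}.
Proof.
move=> u0 m n mn; have mnR : (m%:R <= n%:R :> R)%R by rewrite ler_nat.
rewrite !truncationE//; case: ifP => xm; last first.
  by case: ifP; rewrite ?lexx ?le_min ?u0 ?lee_fin ?ler0n.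
by rewrite (le_trans xm mnR) le_min !ge_min lexx lee_fin mnR orbT.
Qed.

Lemma truncation_cvg (R : realType) (u : R -> \bar R) x : 0 <= u x ->
  (truncation u n x)%:E @[n --> \oo] --> u x.
Proof.
move=> u0; have near_ge (r : R) : \forall n \near \oo, (r <= n%:R)%R.
  by apply: nbhs_infty_ger.
case E : (u x) u0 => [r| |]// r0.
  apply: cvg_near_cst; near=> n; rewrite truncationE ?E// ifT; last by near: n.
  by apply/min_idPl; rewrite lee_fin; near: n.
apply/cvgeyPge => A; near=> n; rewrite truncationE ?E// ifT; last by near: n.
by rewrite le_min leey /= lee_fin; near: n.
Unshelve. all: by end_near. Qed.

Lemma integral_truncation_cvg (R : realType) (u : R -> \bar R) :
  measurable_fun [set: R] u -> (forall x, 0 <= u x) ->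
  \int[lebesgue_measure]_x (truncation u n x)%:E @[n --> \oo] -->
  \int[lebesgue_measure]_x u x.
Proof.
move=> mu u0; rewrite (_ : \int[lebesgue_measure]_x u x =
    \int[lebesgue_measure]_x limn (fun n => (truncation u n x)%:E)); last first.
  by apply: eq_integral => x _; apply/esym/cvg_lim => //; exact: truncation_cvg.
apply: (@cvg_monotone_convergence _ _ R lebesgue_measure setT measurableT
  (fun n x => (truncation u n x)%:E)).
- by move=> n; apply/measurable_EFinP; exact: measurable_truncation.
- by move=> n x _; rewrite lee_fin; case/andP: (truncation_bound n (u0 x)).
- by move=> x _; exact: truncation_nd.
Qed.

Lemma prekopa_leindler (R : realType) (f g h : R -> \bar R) :
  measurable_fun [set: R] f -> measurable_fun [set: R] g -> measurable_fun [set: R] h ->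
  (forall x, 0 <= f x) -> (forall x, 0 <= g x) -> (forall x, 0 <= h x) ->
  (forall x y, f x * g y <= h ((x + y) / 2)%R * h ((x + y) / 2)%R) ->
  (\int[lebesgue_measure]_x f x) * (\int[lebesgue_measure]_x g x) <=
  (\int[lebesgue_measure]_x h x) * (\int[lebesgue_measure]_x h x).
Proof.
move=> mf mg mh f0 g0 h0 fgh.
have F0 : 0 <= \int[lebesgue_measure]_x f x by exact: integral_ge0.
have G0 : 0 <= \int[lebesgue_measure]_x g x by exact: integral_ge0.
have H0 : 0 <= \int[lebesgue_measure]_x h x by exact: integral_ge0.
(* Products do not pass to the limit at 0 times infinity, so vanishing integrals are treated
   apart. *)
have [->|F1] := eqVneq (\int[lebesgue_measure]_x f x) 0; first by rewrite mul0e mule_ge0.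
have [->|G1] := eqVneq (\int[lebesgue_measure]_x g x) 0; first by rewrite mule0 mule_ge0.
have FG : \int[lebesgue_measure]_x f x *? \int[lebesgue_measure]_x g x.
  by rewrite mule_defE (negPf F1) (negPf G1).
have c : (\int[lebesgue_measure]_x (truncation f n x)%:E) *
    (\int[lebesgue_measure]_x (truncation g n x)%:E) @[n --> \oo] -->
    (\int[lebesgue_measure]_x f x) * (\int[lebesgue_measure]_x g x).
  by apply: cvgeM => //; exact: integral_truncation_cvg.
rewrite -(cvg_lim _ c)//; apply: lime_le; first by apply/cvg_ex; eexists; exact: c.
apply: nearW => n.
apply: (@prekopa_leindler_bounded R _ _ h n%:R) => //.
- exact: measurable_truncation.
- exact: measurable_truncation.
- by move=> x; exact: truncation_bound.
- by move=> x; exact: truncation_bound.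
- by move=> x; exact: truncation_support.
- by move=> x; exact: truncation_support.
move=> x y; apply: le_trans (fgh x y).
rewrite EFinM; apply: lee_pmul; rewrite ?lee_fin ?truncation_le//.
  by case/andP: (truncation_bound n (f0 x)).
by case/andP: (truncation_bound n (g0 y)).
Qed.

Local Close Scope ereal_scope.

(** * Lebesgue measure on R^d and the isodiametric inequality *)

Definition tuple_section (R : realType) d (A : set (d.+1.-tuple (measurableTypeR R)))
    (x : R) : set (d.-tuple (measurableTypeR R)) :=
  [set t | A (cons_pair (x, t))].

Lemma xsection_cons_pair (R : realType) d (A : set (d.+1.-tuple (measurableTypeR R))) x :
  xsection (@cons_pair R d @^-1` A) x = tuple_section A x.
Proof. by apply/seteqP; split => t; rewrite /xsection /= inE. Qed.

Lemma measurable_cons_pair_preimage (R : realType) d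
    (A : set (d.+1.-tuple (measurableTypeR R))) :
  measurable A -> measurable (@cons_pair R d @^-1` A).
Proof. by move=> mA; rewrite -[X in measurable X]setTI; exact: measurable_cons_pair. Qed.

Lemma measurable_section (R : realType) d (A : set (d.+1.-tuple (measurableTypeR R))) x :
  measurable A -> measurable (tuple_section A x).
Proof.
move=> /measurable_cons_pair_preimage mA; rewrite -xsection_cons_pair.
exact: measurable_xsection.
Qed.

Lemma measurable_lebesgueRd_section (R : realType) d
    (A : set (d.+1.-tuple (measurableTypeR R))) :
  measurable A -> measurable_fun [set: R] (fun x => lebesgueRd R d (tuple_section A x)).
Proof.
move=> /measurable_cons_pair_preimage mA.
have := measurable_fun_xsection (lebesgueRd R d) mA.
by under eq_fun do rewrite -xsection_cons_pair.
Qed.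

Lemma lebesgueRdS (R : realType) d (A : set (d.+1.-tuple (measurableTypeR R))) :
  lebesgueRd R d.+1 A = (\int[lebesgue_measure]_x lebesgueRd R d (tuple_section A x))%E.
Proof.
by apply: eq_integral => x _; rewrite /= xsection_cons_pair.
Qed.

(** * Homotheties and scaling of volume *)

Definition homothety (R : realType) d (a : R) (b z : d.-tuple R) : d.-tuple R :=
  [tuple a * tnth z i + tnth b i | i < d].

Lemma measurable_homothety (R : realType) d (a : R) (b : d.-tuple R) :
  measurable_fun setT (homothety a b :
    d.-tuple (measurableTypeR R) -> d.-tuple (measurableTypeR R)).
Proof.
apply/measurable_fun_tnthP => i.
rewrite (_ : _ \o _ = (fun x => a * x + tnth b i) \o (fun z => tnth z i)); last first.
  by apply/funext => z /=; rewrite tnth_mktuple.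
by apply: measurableT_comp; [exact: measurable_affine|exact: measurable_tnth].
Qed.

Lemma homothety_cons (R : realType) d (a x : R) (b : d.+1.-tuple R) (t : d.-tuple R) :
  homothety a b (cons_pair (x, t)) =
  cons_pair (a * x + thead b, homothety a [tuple of behead b] t).
Proof.
apply: eq_from_tnth => i; rewrite tnth_mktuple.
case: (unliftP ord0 i) => [j ->|->] //.
by rewrite !tnthS tnth_mktuple [in LHS](tuple_eta b) tnthS.
Qed.

(** The section at x of the preimage is the preimage of the section at [a * x + thead b]. Sections
    contribute d factors 1 / |a| by induction, the change of variable in x one more. *)
Lemma lebesgueRd_homothety (R : realType) d (a : R) (b : d.-tuple R)
    (A : set (d.-tuple (measurableTypeR R))) :
  a != 0 -> measurable A ->
  lebesgueRd R d (homothety a b @^-1` A) = ((`|a|^-1 ^+ d)%:E * lebesgueRd R d A)%E.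
Proof.
move=> a0; elim: d b A => [|d IH] b A mA.
  rewrite expr0 mul1e /= !diracE.
  by congr ((nat_of_bool _)%:R%:E); apply: asbool_equiv_eq; rewrite /= [homothety _ _ _]tuple0.
rewrite !lebesgueRdS.
transitivity (\int[lebesgue_measure]_x
    ((`|a|^-1 ^+ d)%:E * lebesgueRd R d (tuple_section A (a * x + thead b)%R)))%E.
  apply: eq_integral => x _.
  rewrite -(IH [tuple of behead b]); last exact: measurable_section.
  congr (lebesgueRd R d _); apply/seteqP; split => t;
    by rewrite /tuple_section /= homothety_cons.
have m0 x : (0 <= lebesgueRd R d (tuple_section A x))%E by exact: measure_ge0.
have mS := measurable_lebesgueRd_section mA.
rewrite ge0_integralZl//.
- by rewrite (ge0_integral_affine _ a0 mS m0) muleA -EFinM exprSr.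
- exact: (measurableT_comp mS (measurable_affine a (thead b))).
Qed.

(** * The Brunn-Minkowski inequality *)

Definition midpoint (R : realType) d (a b : d.-tuple R) : d.-tuple R :=
  [tuple (tnth a i + tnth b i) / 2 | i < d].

(** Midpoints of the sections of A at x and of B at y fall in the section of C at (x + y) / 2, so
    induction supplies the hypothesis of [prekopa_leindler] for the section measures. Allowing any
    measurable C that contains the midpoints avoids asking whether the set of midpoints is
    measurable. *)
Theorem brunn_minkowski (R : realType) d (A B C : set (d.-tuple (measurableTypeR R))) :
  measurable A -> measurable B -> measurable C ->
  (forall a b, A a -> B b -> C (midpoint a b)) ->
  (lebesgueRd R d A * lebesgueRd R d B <= lebesgueRd R d C * lebesgueRd R d C)%E.
Proof.
elim: d A B C => [|d IH] A B C mA mB mC ABC.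
  rewrite /= !diracE.
  have [Aa|Aa] := boolP ([tuple] \in A); last by rewrite mul0e mule_ge0// lee_fin.
  have [Bb|Bb] := boolP ([tuple] \in B); last by rewrite mule0 mule_ge0// lee_fin.
  rewrite mem_set//; move: Aa Bb; rewrite !inE => Aa Bb.
  by have := ABC _ _ Aa Bb; rewrite [midpoint _ _]tuple0.
rewrite !lebesgueRdS; apply: prekopa_leindler; try exact: measurable_lebesgueRd_section;
  try by move=> x; exact: measure_ge0.
move=> x y; apply: IH; try exact: measurable_section.
move=> s t As Bt; rewrite /tuple_section /=.
rewrite (_ : cons_pair _ = midpoint (cons_pair (x, s)) (cons_pair (y, t))).
  exact: ABC.
apply: eq_from_tnth => i; rewrite tnth_mktuple.
by case: (unliftP ord0 i) => [j ->|->] //; rewrite !tnthS tnth_mktuple.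
Qed.

(** * Euclidean distances and balls *)

Definition sqr_dist (R : realType) d (x y : d.-tuple R) : R :=
  \sum_(i < d) (tnth x i - tnth y i) ^+ 2.

Lemma sqr_dist_ge0 (R : realType) d (x y : d.-tuple R) : 0 <= sqr_dist x y.
Proof. by apply: sumr_ge0 => i _; exact: sqr_ge0. Qed.

Lemma sqr_distC (R : realType) d (x y : d.-tuple R) : sqr_dist x y = sqr_dist y x.
Proof. by apply: eq_bigr => i _; rewrite -sqrrN opprB. Qed.

Lemma eucl_dist_le (R : realType) d (x y : d.-tuple R) r :
  0 <= r -> (eucl_dist x y <= r) = (sqr_dist x y <= r ^+ 2).
Proof.
move=> r0; rewrite -(ler_pXn2r (n := 2))// ?nnegrE ?sqrtr_ge0//.
by rewrite sqr_sqrtr// sqr_dist_ge0.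
Qed.

Definition eball (R : realType) d (r : R) (y : d.-tuple R) : set (d.-tuple R) :=
  [set z | eucl_dist z y <= r].

Definition origin (R : realType) d : d.-tuple R := [tuple 0 | i < d].

Lemma measurable_eball (R : realType) d (r : R) (y : d.-tuple R) :
  0 <= r -> measurable (eball r y : set (d.-tuple (measurableTypeR R))).
Proof.
move=> r0.
have m : measurable_fun setT
    ((fun z => sqr_dist z y) : d.-tuple (measurableTypeR R) -> measurableTypeR R).
  apply: measurable_sum => i; apply: measurable_funX.
  by apply: measurable_funB => //; exact: measurable_tnth.
have := m measurableT `]-oo, r ^+ 2]%classic (measurable_itv _).
rewrite setTI (_ : _ @^-1` _ = eball r y)//.
by apply/seteqP; split => z; rewrite /eball /= in_itv /= eucl_dist_le.
Qed.

Lemma lebesgueRd_eball (R : realType) d (r : R) (y : d.-tuple R) :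
  0 < r -> lebesgueRd R d (eball r y) =
           ((r ^+ d)%:E * lebesgueRd R d (eball 1 (origin R d)))%E.
Proof.
move=> r0; have r0' : r^-1 != 0 by rewrite invr_neq0// gt_eqF.
have m1 := measurable_eball (origin R d) (@ler01 R).
pose b := [tuple - (r^-1 * tnth y i) | i < d].
have := lebesgueRd_homothety b r0' m1.
rewrite normfV invrK gtr0_norm// => <-; congr (lebesgueRd R d _).
have E z : sqr_dist (homothety r^-1 b z) (origin R d) = sqr_dist z y / r ^+ 2.
  rewrite mulr_suml; apply: eq_bigr => i _; rewrite !tnth_mktuple; field.
  by rewrite gt_eqF.
have H z : eball 1 (origin R d) (homothety r^-1 b z) = eball r y z.
  rewrite /eball /mkset !eucl_dist_le ?ler01 ?(ltW r0)// E ler_pdivrMr ?exprn_gt0//.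
  by rewrite expr1n mul1r.
by apply/seteqP; split => z; rewrite /preimage /= H.
Qed.

(** The midpoint of a point of A and one of -A is half a difference of points of A, so it lies in
    the ball of radius r. Brunn-Minkowski then compares the squared volumes. *)
Lemma isodiametric (R : realType) d (r : R) (A : set (d.-tuple (measurableTypeR R))) :
  0 < r -> measurable A ->
  (forall x y, A x -> A y -> sqr_dist x y <= (2 * r) ^+ 2) ->
  (lebesgueRd R d A <= (r ^+ d)%:E * lebesgueRd R d (eball 1 (origin R d)))%E.
Proof.
move=> r0 mA diamA.
pose B := homothety (- 1) (origin R d) @^-1` A.
have mB : measurable (B : set (d.-tuple (measurableTypeR R))).
  by rewrite -[X in measurable X]setTI; exact: (@measurable_homothety R d).
have vB : lebesgueRd R d B = lebesgueRd R d A.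
  by rewrite lebesgueRd_homothety ?oppr_eq0 ?oner_eq0// normrN1 invr1 expr1n mul1e.
rewrite -(lebesgueRd_eball (origin R d) r0).
have mC := measurable_eball (origin R d) (ltW r0).
have mid : forall a b, A a -> B b -> eball r (origin R d) (midpoint a b).
  move=> a b Aa Ab; rewrite /eball /= eucl_dist_le ?(ltW r0)//.
  have := diamA _ _ Aa Ab.
  rewrite (_ : sqr_dist a _ = 4 * sqr_dist (midpoint a b) (origin R d)).
    by rewrite exprMn -natrX ler_pM2l.
  rewrite mulr_sumr; apply: eq_bigr => i _; rewrite !tnth_mktuple; by field.
have := brunn_minkowski mA mB mC mid; rewrite vB.
have : (0 <= lebesgueRd R d (eball r (origin R d)))%E by exact: measure_ge0.
have : (0 <= lebesgueRd R d A)%E by exact: measure_ge0.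
case: (lebesgueRd R d A) => [a| |]//; case: (lebesgueRd R d (eball _ _)) => [c| |]//;
  rewrite ?leey// -?EFinM ?mulyy ?lee_fin//.
by move=> a0 c0; rewrite -!expr2 ler_pXn2r// nnegrE.
Qed.

(* Extremal case: y1, y2, x span an equilateral triangle of side 2, and z lies
   beyond x on the axis through the midpoint of y1 and y2. *)
Lemma near_one_of_two_neighbours (R : realType) d (x y1 y2 z : d.-tuple R) :
  eucl_dist z x <= 1 -> eucl_dist x y1 <= 2 -> eucl_dist x y2 <= 2 ->
  2 < eucl_dist y1 y2 ->
  eucl_dist z y1 <= rho2 R \/ eucl_dist z y2 <= rho2 R.
Proof.
rewrite ltNge !eucl_dist_le ?sqrtr_ge0// -ltNge expr1n => zx xy1 xy2 yy.
pose s : R := Num.sqrt 3.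
have s0 : 0 < s by rewrite sqrtr_gt0.
have s2 : s * s = 3 by rewrite -expr2 sqr_sqrtr.
rewrite /rho2 -/s sqr_sqrtr; last by rewrite addr_ge0// mulr_ge0// ltW.
(* Under the hypotheses the right-hand side is at most 10 + 4 s, twice the square of [rho2]. The
   weights make the slack a sum of squares that vanishes in the extremal case. *)
have : sqr_dist z y1 + sqr_dist z y2 <= (2 + 2 * s) * sqr_dist z x +
    (1 + s / 3) * (sqr_dist x y1 + sqr_dist x y2) - s / 6 * sqr_dist y1 y2.
  rewrite /sqr_dist -!big_split /= !mulr_sumr -big_split -sumrB /=.
  apply: ler_sum => i _; rewrite -subr_ge0.
  set zi := tnth z i; set xi := tnth x i; set ai := tnth y1 i; set bi := tnth y2 i.
  rewrite (_ : _ - _ = 2 * s * (zi - xi + s * (ai + bi - 2 * xi) / 6) ^+ 2).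
    by rewrite mulr_ge0 ?sqr_ge0// mulr_ge0// ltW.
  (* The two sides differ by a multiple of 3 - s * s. *)
  apply/eqP; rewrite -subr_eq0; apply/eqP.
  transitivity ((3 - s * s) * (2 / 3 * (zi - xi) * (ai + bi - 2 * xi) +
    s / 18 * (ai + bi - 2 * xi) ^+ 2)); last by rewrite s2 subrr mul0r.
  by field.
have [|] := leP (sqr_dist z y1) (5 + 2 * s); first by left.
have [|] := leP (sqr_dist z y2) (5 + 2 * s); first by right.
move: (sqr_dist z y1) (sqr_dist z y2) (sqr_dist z x) (sqr_dist x y1) (sqr_dist x y2)
  (sqr_dist y1 y2) zx xy1 xy2 yy => p q a b c e; nra.
Qed.

(** Cauchy-Schwarz with weights 1, 2, 1 on z - z' = (z - x) + (x - x') + (x' - z') gives 4 (1 + 4 /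
    2 + 1) = 16. *)
Lemma clique_unit_balls_diameter (R : realType) d (x x' z z' : d.-tuple R) :
  eucl_dist x x' <= 2 -> eucl_dist z x <= 1 -> eucl_dist z' x' <= 1 ->
  sqr_dist z z' <= (2 * 2) ^+ 2.
Proof.
rewrite !eucl_dist_le// expr1n => xx zx zx'.
have : sqr_dist z z' <=
    4 * (sqr_dist z x + 2^-1 * sqr_dist x x' + sqr_dist z' x').
  rewrite /sqr_dist mulr_sumr -!big_split mulr_sumr.
  apply: ler_sum => i _ /=.
  set zi := tnth z i; set xi := tnth x i; set zi' := tnth z' i; set xi' := tnth x' i.
  have := sqr_ge0 (zi - xi - (xi - xi') / 2).
  have := sqr_ge0 (zi' - xi' + (xi - xi') / 2).
  have := sqr_ge0 (zi - xi + (zi' - xi')).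
  nra.
by move: (sqr_dist z x) (sqr_dist x x') (sqr_dist z' x') xx zx zx' => a b c; lra.
Qed.

(** Coordinatewise (p - q)^2 <= 2 (p^2 + q^2), so centers whose balls share z are at most 2
    apart. *)
Lemma far_unit_balls_disjoint (R : realType) d (y y' z : d.-tuple R) :
  2 < eucl_dist y y' -> eucl_dist z y <= 1 -> eucl_dist z y' <= 1 -> False.
Proof.
rewrite ltNge !eucl_dist_le// expr1n => /negP yy zy zy'; apply: yy.
have : sqr_dist y y' <= 2 * (sqr_dist z y + sqr_dist z y').
  rewrite /sqr_dist -big_split mulr_sumr; apply: ler_sum => i _ /=.
  set zi := tnth z i; set yi := tnth y i; set yi' := tnth y' i.
  have := sqr_ge0 (2 * zi - yi - yi'); nra.
by move: (sqr_dist z y) (sqr_dist z y') zy zy' => a b; lra.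
Qed.

(** * Swap-optimal sets of balls *)

Lemma measurable_union_unit_balls (R : realType) d (X : seq (d.-tuple R)) :
  measurable (union_unit_balls X : set (d.-tuple (measurableTypeR R))).
Proof.
apply: fin_bigcup_measurable; first exact: finite_seq.
by move=> x _; exact: (measurable_eball x (@ler01 R)).
Qed.

Section swap_optimal.
Context (R : realType) (d : nat) (X Y : seq (d.-tuple R)).
Hypothesis uniqY : uniq Y.
Hypothesis indep : {in Y &, forall y y', y <> y' -> 2 < eucl_dist y y'}.
Hypothesis cover : forall x, x \in X -> exists2 y, y \in Y & eucl_dist x y <= 2.
Hypothesis no_swap : forall x x' y, x \in X -> x' \in X -> y \in Y ->
  (forall y', y' \in Y -> eucl_dist x y' <= 2 -> y' = y) ->
  (forall y', y' \in Y -> eucl_dist x' y' <= 2 -> y' = y) ->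
  eucl_dist x x' <= 2.

Let private y := [seq x <- X | all (fun y' => (eucl_dist x y' <= 2) ==> (y' == y)) Y].

Let privateP x y : x \in private y ->
  x \in X /\ forall y', y' \in Y -> eucl_dist x y' <= 2 -> y' = y.
Proof.
rewrite mem_filter => /andP[/allP xy xX]; split => // y' /xy /implyP yy' xy'.
exact/eqP/yy'.
Qed.

Let omega := lebesgueRd R d (eball 1 (origin R d)).

(** Two centers in [private y] are within distance 2 by [no_swap], so the union of their balls has
    diameter at most 4. *)
Lemma private_measure y : y \in Y ->
  (lebesgueRd R d (union_unit_balls (private y)) <= (2 ^+ d)%:E * omega)%E.
Proof.
move=> yY; apply: isodiametric => //; first exact: measurable_union_unit_balls.
move=> z z' [x /privateP[xX xy] zx] [x' /privateP[x'X x'y] zx'].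
by apply: (@clique_unit_balls_diameter R d x x') => //; exact: (no_swap xX x'X yY).
Qed.

Lemma rho2_gt0 : 0 < rho2 R.
Proof. by rewrite sqrtr_gt0 addr_gt0// mulr_gt0// sqrtr_gt0. Qed.

(** A center not private to its neighbour y has a second neighbour y', more than 2 away from y;
    [near_one_of_two_neighbours] then places z. *)
Lemma swap_optimal_cover :
  union_unit_balls X `<=`
  \bigcup_(y in [set` Y]) (eball (rho2 R) y `|` union_unit_balls (private y)).
Proof.
move=> z [x /= xX zx]; have [y yY xy] := cover xX.
have [xp|] := boolP (x \in private y); first by exists y => //; right; exists x.
rewrite mem_filter xX andbT => /allPn[y' y'Y]; rewrite negb_imply => /andP[xy' /eqP yy'].
have yy : 2 < eucl_dist y y' by apply: indep => // e; exact: yy'.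
have [zy|zy'] := near_one_of_two_neighbours zx xy xy' yy.
  by exists y => //; left.
by exists y' => //; left.
Qed.

Lemma swap_optimal_measure :
  ((1 / (2 ^+ d + rho2 R ^+ d))%:E * lebesgueRd R d (union_unit_balls X)
    <= lebesgueRd R d (union_unit_balls Y))%E.
Proof.
pose c := 2 ^+ d + rho2 R ^+ d.
have c0 : 0 < c by rewrite addr_gt0// exprn_gt0// rho2_gt0.
have mS y : measurable (eball (rho2 R) y `|` union_unit_balls (private y)
    : set (d.-tuple (measurableTypeR R))).
  apply: measurableU; last exact: measurable_union_unit_balls.
  by apply: measurable_eball; rewrite ltW// rho2_gt0.
(* The balls around Y are disjoint, so each y contributes exactly omega. *)
have muY : lebesgueRd R d (union_unit_balls Y) = (\sum_(y \in [set` Y]) omega)%E.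
  rewrite /union_unit_balls measure_fin_bigcup//; last 3 first.
  - exact: finite_seq.
  - apply/trivIsetP => y y' /= yY y'Y /eqP yy'; apply/seteqP; split => // z [zy zy'].
    exact: (far_unit_balls_disjoint (indep yY y'Y yy') zy zy').
  - by move=> y _; exact: (measurable_eball y (@ler01 R)).
  apply: eq_fsbigr => y _.
  by have := lebesgueRd_eball y (@ltr01 R); rewrite expr1n mul1e.
(* Each y accounts for at most rho2^d omega from the large ball and 2^d omega from its private
   balls. *)
have muX : (lebesgueRd R d (union_unit_balls X) <= c%:E * \sum_(y \in [set` Y]) omega)%E.
  have : (lebesgueRd R d (union_unit_balls X) <= \sum_(y \in [set` Y])
      lebesgueRd R d (eball (rho2 R) y `|` union_unit_balls (private y)))%E.
    apply: content_sub_fsum; [exact: finite_seq|by move=> y _; exact: mS| |].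
      exact: measurable_union_unit_balls.
    exact: swap_optimal_cover.
  move=> /le_trans; apply.
  rewrite -!fsbig_seq// ge0_sume_distrr; last by move=> y _; exact: measure_ge0.
  rewrite big_seq [leRHS]big_seq; apply: lee_sum => y yY.
  rewrite EFinD ge0_muleDl ?lee_fin ?exprn_ge0 ?(ltW rho2_gt0)// addeC.
  apply: (le_trans (measureU2 _ _ _)).
  - by apply: measurable_eball; rewrite ltW// rho2_gt0.
  - exact: measurable_union_unit_balls.
  - by apply: leeD; [rewrite -(lebesgueRd_eball y rho2_gt0)|exact: private_measure].
rewrite muY -/c div1r -(@lee_pmul2l _ c%:E)// ?lte_fin//.
by rewrite muleA -EFinM divff ?gt_eqF// mul1e.
Qed.

End swap_optimal.

(** * Transfer from indices to points *)

Lemma eucl_distC (R : realType) d (x y : d.-tuple R) : eucl_dist x y = eucl_dist y x.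
Proof. by rewrite /eucl_dist -![\sum_(i < d) _]/(sqr_dist _ _) sqr_distC. Qed.

Lemma eucl_dist_refl (R : realType) d (x : d.-tuple R) : eucl_dist x x = 0.
Proof.
rewrite /eucl_dist big1 ?sqrtr0// => i _.
by rewrite subrr expr0n.
Qed.

Lemma ball_test_nth (R : realType) d (X : seq (d.-tuple R)) x0 i j :
  (i < size X)%N -> (j < size X)%N ->
  ball_test X i j = (eucl_dist (nth x0 X i) (nth x0 X j) <= 2).
Proof. by move=> iX jX; rewrite /ball_test !onthE !(nth_map x0). Qed.

Lemma ball_test_sym (R : realType) d (X : seq (d.-tuple R)) : symmetric (ball_test X).
Proof.
move=> i j; rewrite /ball_test.
by case: (onth X i) => [x|]; case: (onth X j) => [y|] //; rewrite eucl_distC.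
Qed.

Lemma mem_selected (R : realType) d (X : seq (d.-tuple R)) s y :
  (y \in selected X s) = chosen s (index y X) && (y \in X).
Proof. by rewrite mem_filter. Qed.

Local Close Scope classical_set_scope.

Theorem mainTheorem4 (R : realType) :
  exists (algo : cmd) (p : {poly nat}),
    forall (d : nat) (X : seq (d.-tuple R)), uniq X ->
    exists (t : nat) (s : state),
      [/\ exec (ball_test X) algo (initial (size X)) t s,
          (t <= p.[size X])%N &
          let Y := selected X s in
          [/\ {subset Y <= X},
              {in Y &, forall y y', y <> y' -> 2 < eucl_dist y y'} &
              ((1 / (2 ^+ d + rho2 R ^+ d))%:E
                 * lebesgueRd R d (union_unit_balls X)
               <= lebesgueRd R d (union_unit_balls Y))%E]].
Proof.
exists local_search.
(* The time bound of [wp_local_search] as a polynomial in n. *)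
exists ('X * ('X * ('X * ('X * (16%N)%:P + (13%N)%:P) + (4%N)%:P) + (4%N)%:P) + (4%N)%:P).
move=> d X uX; set n := size X.
have test_refl i : (i < n)%N -> ball_test X i i.
  move=> iX; case: X uX @n iX => // x X _ n iX.
  by rewrite (ball_test_nth x)// eucl_dist_refl.
have test_sym := @ball_test_sym R d X.
have [t [s [run time [[_ indep pos] opt]]]] := wp_local_search test_refl test_sym.
exists t, s; split => //; first by rewrite !(hornerD, hornerM, hornerX, hornerC).
have indexE x y : x \in X -> y \in X ->
    ball_test X (index x X) (index y X) = (eucl_dist x y <= 2).
  by move=> xX yX; rewrite (ball_test_nth x) ?index_mem// !nth_index.
(* As X has no duplicates, [index] inverts [nth], so facts about indices become facts about
   points. *)
have chosenE x0 k : (k < n)%N -> chosen s k ->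
    nth x0 X k \in selected X s /\ index (nth x0 X k) X = k.
  by move=> kn sk; rewrite mem_selected index_uniq// sk mem_nth.
have sep : {in selected X s &, forall y y', y <> y' -> 2 < eucl_dist y y'}.
  move=> y y'; rewrite !mem_selected => /andP[sy yX] /andP[sy' y'X] yy'.
  rewrite ltNge; apply/negP; rewrite -indexE// => tyy'; apply: yy'.
  rewrite -(nth_index y yX) -[RHS](nth_index y y'X); congr nth.
  by apply: indep; rewrite ?index_mem.
split => //; first by move=> y; rewrite mem_selected => /andP[].
apply: swap_optimal_measure => //; first exact: filter_uniq.
- move=> x xX; have ix : (index x X < n)%N by rewrite index_mem.
  have [k [kn sk txk]] := swap_optimal_dominating test_sym indep pos opt ix.
  have [kY kE] := chosenE x k kn sk; exists (nth x X k) => //.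
  by rewrite -indexE ?kE// mem_nth.
- move=> x x' y xX x'X; rewrite mem_selected => /andP[sy yX] xy x'y.
  rewrite -indexE//; apply: (swap_optimal_private test_sym opt (j := index y X));
    rewrite ?index_mem// => k kn sk tk.
  + have [kY kE] := chosenE x k kn sk; rewrite -kE; congr index; apply: xy => //.
    by rewrite -indexE ?kE// mem_nth.
  + have [kY kE] := chosenE x k kn sk; rewrite -kE; congr index; apply: x'y => //.
    by rewrite -indexE ?kE// mem_nth.
Qed.
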